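(* Let $D_1,D_2\ge2$, $D=D_1D_2$, and for $j=1,2$ let $\varrho_\perp^{(D_j)}$ be a density operator on $\mathbb{C}^{D_j}$ with $\langle f_1^{(D_j)}|\varrho_\perp^{(D_j)}|f_1^{(D_j)}\rangle=0$. Write $f^{(D_j)}=|f_1^{(D_j)}\rangle\langle f_1^{(D_j)}|$. For $p\in[0,1]$ define $$\varrho_{\min}(p)=p\,f^{(D_1)}\otimes f^{(D_2)}+(1-p)\,\varrho_\perp^{(D_1)}\otimes\varrho_\perp^{(D_2)},$$ $$\varrho_{\max}(p)=p\,f^{(D_1)}\otimes f^{(D_2)}+\tfrac{1-p}{2}\,f^{(D_1)}\otimes\varrho_\perp^{(D_2)}+\tfrac{1-p}{2}\,\varrho_\perp^{(D_1)}\otimes f^{(D_2)}.$$ Then for every $p\in[0,1]$, $\Sigma(\varrho_{\min}(p))=\Sigma(\varrho_{\max}(p))=pD$, and $$\Sigma(\mathrm{Tr}_2\,\varrho_{\min}(p))\,\Sigma(\mathrm{Tr}_1\,\varrho_{\min}(p))=\frac{\Sigma(\varrho_{\min}(p))^2}{D},$$ $$\Sigma(\mathrm{Tr}_2\,\varrho_{\max}(p))\,\Sigma(\mathrm{Tr}_1\,\varrho_{\max}(p))=\frac{[D+\Sigma(\varrho_{\max}(p))]^2}{4D}.$$ Consequently, the bounds $\frac{\Sigma(\varrho)^2}{D}\le\Sigma(\mathrm{Tr}_2\varrho)\Sigma(\mathrm{Tr}_1\varrho)\le\frac{[D+\Sigma(\varrho)]^2}{4D}$, valid for all density operators $\varrho$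 on $\mathbb{C}^{D_1}\otimes\mathbb{C}^{D_2}$, are both tight at every value of the global grand sum $\Sigma(\varrho)\in[0,D]$.
   Context: For a density operator $\omega$ on $\mathbb{C}^{d}$ the grand sum is $\Sigma(\omega)=\sum_{i,j=1}^{d}\omega_{ij}=d\,\langle f_1^{(d)}|\omega|f_1^{(d)}\rangle$, where matrix entries are taken in the standard basis and $|f_1^{(d)}\rangle=\frac1{\sqrt d}\sum_{j=1}^d|j\rangle$. For the bipartite space $\mathbb{C}^{D_1}\otimes\mathbb{C}^{D_2}$ the product standard basis is used, so that $|f_1^{(D)}\rangle=|f_1^{(D_1)}\rangle\otimes|f_1^{(D_2)}\rangle$. *)

(* Defs.v *)
From HB Require Import structures.
From mathcomp Require Import all_boot all_order all_algebra.
From mathcomp Require Import reals.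
From mathcomp.real_closed Require Import complex mxtens.

Set Implicit Arguments.
Unset Strict Implicit.
Unset Printing Implicit Defensive.

Import Order.TTheory GRing.Theory Num.Theory.

Local Open Scope ring_scope.
Local Open Scope complex_scope.
Local Open Scope sesquilinear_scope.

(* Operators on C^d are matrices in the standard basis, over C = R[i]; vectors
   (kets) are columns.  On R[i], x <= y means that y - x is a nonnegative real
   number, so inequalities between complex quantities also assert that they
   differ by a real number. *)

Definition expect (R : realType) (d : nat) (v : 'cV[R[i]]_d)
    (A : 'M[R[i]]_d) : R[i] :=
  (v ^t* *m A *m v) 0 0.

Definition density (R : realType) (d : nat) (rho : 'M[R[i]]_d) : Prop :=
  [/\ rho \is hermsymmx,
      forall v : 'cV[R[i]]_d, 0 <= expect v rho
    & \tr rho = 1].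

Definition grand_sum (R : realType) (d : nat) (w : 'M[R[i]]_d) : R[i] :=
  \sum_(i < d) \sum_(j < d) w i j.

Definition ket_f1 (R : realType) (d : nat) : 'cV[R[i]]_d :=
  \col_(j < d) (sqrtC d%:R)^-1.

Definition proj_f1 (R : realType) (d : nat) : 'M[R[i]]_d :=
  ket_f1 R d *m (ket_f1 R d) ^t*.

(* The standard basis of C^D1 (x) C^D2 is indexed by 'I_(D1 * D2) through
   mxtens_index (i, j) = i * D2 + j, the indexing used by tensmx (A *t B). *)

Definition ptrace2 (R : realType) (D1 D2 : nat) (rho : 'M[R[i]]_(D1 * D2)) :
    'M[R[i]]_D1 :=
  \matrix_(i < D1, k < D1)
    \sum_(j < D2) rho (mxtens_index (i, j)) (mxtens_index (k, j)).

Definition ptrace1 (R : realType) (D1 D2 : nat) (rho : 'M[R[i]]_(D1 * D2)) :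
    'M[R[i]]_D2 :=
  \matrix_(j < D2, l < D2)
    \sum_(i < D1) rho (mxtens_index (i, j)) (mxtens_index (i, l)).

Definition rho_min (R : realType) (D1 D2 : nat) (r1 : 'M[R[i]]_D1)
    (r2 : 'M[R[i]]_D2) (p : R) : 'M[R[i]]_(D1 * D2) :=
  p%:C *: (proj_f1 R D1 *t proj_f1 R D2) + (1 - p)%:C *: (r1 *t r2).

Definition rho_max (R : realType) (D1 D2 : nat) (r1 : 'M[R[i]]_D1)
    (r2 : 'M[R[i]]_D2) (p : R) : 'M[R[i]]_(D1 * D2) :=
  p%:C *: (proj_f1 R D1 *t proj_f1 R D2)
  + ((1 - p) / 2)%:C *: (proj_f1 R D1 *t r2)
  + ((1 - p) / 2)%:C *: (r1 *t proj_f1 R D2).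

Lemma grand_sum_expect (R : realType) (d : nat) (w : 'M[R[i]]_d) :
  grand_sum w = d%:R * expect (ket_f1 R d) w.
Proof.
case: d w => [|d] w; first by rewrite /grand_sum big_ord0 mul0r.
have cf : Num.conj ((sqrtC d.+1%:R)^-1 : R[i]) = (sqrtC d.+1%:R)^-1.
  by rewrite conj_Creal // rpredV ger0_real // sqrtC_ge0 ler0n.
rewrite /expect mxE /grand_sum exchange_big mulr_sumr; apply: eq_bigr => j _.
rewrite !mxE mulr_suml mulr_sumr; apply: eq_bigr => i _.
rewrite !mxE cf mulrAC -invfM -expr2 sqrtCK mulrA mulfV ?mul1r //.
by rewrite pnatr_eq0.
Qed.

Lemma ket_f1_tens (R : realType) (D1 D2 : nat) :
  ket_f1 R (D1 * D2) = ket_f1 R D1 *t ket_f1 R D2.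
Proof.
apply/matrixP => i j; rewrite !mxE natrM -invfM; congr (_^-1).
by rewrite rootCMl ?ler0n.
Qed.

(* Main.v *)
Require Import Defs.
From HB Require Import structures.
From mathcomp Require Import all_boot all_order all_algebra.
From mathcomp Require Import ring reals.
From mathcomp.real_closed Require Import complex mxtens.

Set Implicit Arguments.
Unset Strict Implicit.
Unset Printing Implicit Defensive.

Import Order.TTheory GRing.Theory Num.Theory.

(* Write f for the uniform projector.  Then Sigma(rho) / D, Sigma(Tr_2 rho) / D1
   and Sigma(Tr_1 rho) / D2 are the expectations s, a, b of f (x) f, f (x) 1 and
   1 (x) f.  Positivity of rho against products of f and 1 - f gives
   0 <= s <= a, s <= b and a + b <= 1 + s, hence
   s^2 <= a b <= ((a + b) / 2)^2 <= ((1 + s) / 2)^2.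
   For the extremal families a = b = p = s and a = b = (1 + p) / 2; orthogonal
   states exist since D1, D2 >= 2: take (1 - f) / (d - 1). *)

Local Open Scope ring_scope.
Local Open Scope complex_scope.
Local Open Scope sesquilinear_scope.

(** * Traces and tensor products over the composite index *)

Lemma sum_mxtens_index (V : nmodType) m n (F : 'I_(m * n) -> V) :
  \sum_k F k = \sum_(i < m) \sum_(j < n) F (mxtens_index (i, j)).
Proof.
rewrite pair_bigA (reindex (@mxtens_index m n)) /=; last first.
  by exists (@mxtens_unindex m n) => ? _;
    [exact: mxtens_indexK | exact: mxtens_unindexK].
by apply: eq_bigr => -[].
Qed.

Lemma mxtrace_tens (S : comPzRingType) m n (A : 'M[S]_m) (B : 'M[S]_n) :
  \tr (A *t B) = \tr A * \tr B.
Proof.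
rewrite /mxtrace sum_mxtens_index big_distrlr.
by do 2![apply: eq_bigr => ? _]; rewrite tensmxE.
Qed.

Lemma tensmxBl (S : pzRingType) m n p q (A B : 'M[S]_(m, n)) (M : 'M[S]_(p, q)) :
  (A - B) *t M = A *t M - B *t M.
Proof. by apply/matrixP => i j; rewrite !mxE mulrBl. Qed.

Lemma tensmxBr (S : pzRingType) m n p q (M : 'M[S]_(m, n)) (A B : 'M[S]_(p, q)) :
  M *t (A - B) = M *t A - M *t B.
Proof. by apply/matrixP => i j; rewrite !mxE mulrBr. Qed.

Lemma tensmx11 (S : pzRingType) m n : 1%:M *t 1%:M = 1%:M :> 'M[S]_(m * n).
Proof.
apply/matrixP => i j; case: (mxtens_indexP i) => i0 i1.
case: (mxtens_indexP j) => j0 j1; rewrite tensmxE !mxE.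
rewrite (inj_eq (can_inj (@mxtens_indexK m n))) xpair_eqE.
by case: eqP; case: eqP; rewrite ?mulr1 ?mulr0.
Qed.

(** * Positive semidefinite operators *)

Section PositiveOperators.

Variable C : numClosedFieldType.

Lemma adjmxM m n p (A : 'M[C]_(m, n)) (B : 'M[C]_(n, p)) :
  (A *m B) ^t* = B ^t* *m A ^t*.
Proof. by rewrite trmx_mul map_mxM. Qed.

Lemma adjmxK m n (A : 'M[C]_(m, n)) : A ^t* ^t* = A.
Proof. by apply/matrixP => i j; rewrite !mxE conjCK. Qed.

Lemma adjmxZ m n (c : C) (A : 'M[C]_(m, n)) : (c *: A) ^t* = c^* *: A ^t*.
Proof. by apply/matrixP => i j; rewrite !mxE rmorphM. Qed.

Lemma adjmx_tens m n p q (A : 'M[C]_(m, n)) (B : 'M[C]_(p, q)) :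
  (A *t B) ^t* = A ^t* *t B ^t*.
Proof. by rewrite trmx_tens map_mxT. Qed.

(** Positivity as a Gram factorization: factors can be tensored directly, whereas nonnegativity of
    the quadratic form does not pass to tensor products so easily. The free number of rows allows
    stacking factors for sums. *)
Definition psd n (A : 'M[C]_n) := exists m (B : 'M[C]_(m, n)), A = B ^t* *m B.

Lemma psd_mx_adj m n (B : 'M[C]_(m, n)) : psd (B *m B ^t*).
Proof. by exists n, (B ^t*); rewrite adjmxK. Qed.

Lemma psd_herm n (A : 'M[C]_n) : psd A -> A ^t* = A.
Proof. by case=> m [B ->]; rewrite adjmxM adjmxK. Qed.

Lemma psdD n (A B : 'M[C]_n) : psd A -> psd B -> psd (A + B).
Proof.
move=> [m1 [M1 ->]] [m2 [M2 ->]]; exists (m1 + m2)%N, (col_mx M1 M2).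
by rewrite tr_col_mx map_row_mx mul_row_col.
Qed.

Lemma psdZ n (c : C) (A : 'M[C]_n) : 0 <= c -> psd A -> psd (c *: A).
Proof.
move=> c0 [m [B ->]]; exists m, (sqrtC c *: B).
rewrite adjmxZ -scalemxAl -scalemxAr scalerA.
by rewrite conj_Creal ?ger0_real ?sqrtC_ge0 // -expr2 sqrtCK.
Qed.

Lemma psd_tens m n (A : 'M[C]_m) (B : 'M[C]_n) : psd A -> psd B -> psd (A *t B).
Proof.
move=> [m1 [M1 ->]] [m2 [M2 ->]]; exists (m1 * m2)%N, (M1 *t M2).
by rewrite adjmx_tens tensmx_mul.
Qed.

Lemma mxtrace_adj_mul_ge0 m n (B : 'M[C]_(m, n)) : 0 <= \tr (B *m B ^t*).
Proof.
apply: sumr_ge0 => i _; rewrite mxE; apply: sumr_ge0 => j _.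
by rewrite !mxE mul_conjC_ge0.
Qed.

(** With Gram factors [M] of [A] and [N] of [B], cyclicity turns the trace into the squared
    Hilbert-Schmidt norm of [M *m N ^t*]. *)
Lemma mxtrace_psd_mul_ge0 n (A B : 'M[C]_n) :
  psd A -> psd B -> 0 <= \tr (A *m B).
Proof.
move=> [m1 [M ->]] [m2 [N ->]]; rewrite -mulmxA mxtrace_mulC.
have -> : M *m (N ^t* *m N) *m M ^t* = (M *m N ^t*) *m (M *m N ^t*) ^t*.
  by rewrite adjmxM adjmxK !mulmxA.
exact: mxtrace_adj_mul_ge0.
Qed.

Lemma psd_projection n (P : 'M[C]_n) : P ^t* = P -> P *m P = P -> psd P.
Proof. by move=> hP PP; exists n, P; rewrite hP PP. Qed.

Lemma psd_compl_projection n (P : 'M[C]_n) :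
  P ^t* = P -> P *m P = P -> psd (1%:M - P).
Proof.
move=> hP PP; apply: psd_projection.
  by rewrite linearB map_mxB /= trmx1 map_mx1 hP.
by rewrite mulmxBl mul1mx mulmxBr mulmx1 PP subrr subr0.
Qed.

(* The square root of a positive operator comes from its spectral decomposition. *)
Lemma hermitian_psd n (A : 'M[C]_n) : A \is hermsymmx ->
  (forall v : 'cV[C]_n, 0 <= (v ^t* *m A *m v) 0 0) -> psd A.
Proof.
move=> hA Apos; have /orthomx_spectralP A_eq := hermitian_normalmx hA.
have Pu := spectral_unitarymx A.
move: Pu A_eq; set P := spectralmx A; set s := spectral_diag A => Pu A_eq.
have sP i : 0 <= s 0 i.
  (* Testing positivity on the [i]-th eigenvector returns the [i]-th eigenvalue. *)
  pose e : 'cV[C]_n := delta_mx i 0.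
  have := Apos (P ^t* *m e).
  have -> : (P ^t* *m e) ^t* *m A *m (P ^t* *m e) = e ^t* *m diag_mx s *m e.
    by rewrite A_eq invmx_unitary // adjmxM adjmxK !mulmxA !mulmxtVK.
  by rewrite /e trmx_delta map_delta_mx -rowE -colE !mxE eqxx mulr1n.
(* The eigenvalues are nonnegative, so their roots are real and the adjoint of this factor times
   itself restores [s]. *)
exists n, (diag_mx (map_mx sqrtC s) *m P).
rewrite adjmxM tr_diag_mx map_diag_mx -mulmxA [X in _ *m X]mulmxA mulmx_diag.
rewrite [LHS]A_eq invmx_unitary // -mulmxA; congr (_ *m (diag_mx _ *m _)).
apply/rowP => i; rewrite !mxE [X in X * _]conj_Creal ?ger0_real ?sqrtC_ge0 //.
by rewrite -expr2 sqrtCK.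
Qed.

End PositiveOperators.

(** * Grand sums as traces against the uniform projector *)

Section GrandSum.

Variable R : realType.

Lemma expect_trace d (v : 'cV[R[i]]_d) (A : 'M[R[i]]_d) :
  expect v A = \tr (A *m (v *m v ^t*)).
Proof. by rewrite /expect -trace_mx11 -mulmxA mxtrace_mulC mulmxA. Qed.

(** Passing to Gram form gives access to the closure properties of [psd] and to the nonnegative
    trace pairing. *)
Lemma densityP d (A : 'M[R[i]]_d) : density A <-> psd A /\ \tr A = 1.
Proof.
split=> [[hA Apos trA]|[Apsd trA]]; first by split; first exact: hermitian_psd.
split=> // [|v].
  by apply/is_hermitianmxP; rewrite expr0 scale1r psd_herm.
by rewrite expect_trace; apply: mxtrace_psd_mul_ge0 => //; exact: psd_mx_adj.
Qed.

Lemma grand_sum_trace d (A : 'M[R[i]]_d) :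
  grand_sum A = d%:R * \tr (A *m proj_f1 R d).
Proof. by rewrite grand_sum_expect expect_trace. Qed.

Lemma proj_f1_adj d : (proj_f1 R d) ^t* = proj_f1 R d.
Proof. by rewrite adjmxM adjmxK. Qed.

Lemma ket_f1_norm d : (0 < d)%N -> (ket_f1 R d) ^t* *m ket_f1 R d = 1%:M.
Proof.
move=> d0; rewrite [LHS]mx11_scalar !mxE; congr (_%:M).
under eq_bigr => j _.
  rewrite !mxE conj_Creal ?rpredV ?ger0_real ?sqrtC_ge0 ?ler0n //.
  rewrite -invfM -expr2 sqrtCK; over.
by rewrite sumr_const card_ord -[LHS]mulr_natl mulfV // pnatr_eq0 -lt0n.
Qed.

Lemma proj_f1_idem d : (0 < d)%N -> proj_f1 R d *m proj_f1 R d = proj_f1 R d.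
Proof.
by move=> d0; rewrite /proj_f1 mulmxA -[X in X *m _]mulmxA ket_f1_norm ?mulmx1.
Qed.

Lemma psd_proj_f1 d : psd (proj_f1 R d).
Proof. exact: psd_mx_adj. Qed.

Lemma psd_compl_proj_f1 d : (0 < d)%N -> psd (1%:M - proj_f1 R d).
Proof.
by move=> d0; apply: psd_compl_projection; [exact: proj_f1_adj|exact: proj_f1_idem].
Qed.

Lemma trace_proj_f1 d : (0 < d)%N -> \tr (proj_f1 R d) = 1.
Proof. by move=> d0; rewrite mxtrace_mulC ket_f1_norm // mxtrace1. Qed.

Lemma proj_f1_tens D1 D2 : proj_f1 R (D1 * D2) = proj_f1 R D1 *t proj_f1 R D2.
Proof. by rewrite /proj_f1 -tensmx_mul -adjmx_tens -ket_f1_tens. Qed.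

(** The partial trace is dual to tensoring with the identity. This makes a marginal grand sum an
    expectation in the global state. *)
Lemma trace_ptrace2_mul D1 D2 (A : 'M[R[i]]_(D1 * D2)) (X : 'M[R[i]]_D1) :
  \tr (ptrace2 A *m X) = \tr (A *m (X *t 1%:M)).
Proof.
rewrite /mxtrace sum_mxtens_index; apply: eq_bigr => i _.
rewrite mxE; under [RHS]eq_bigr => j _.
  rewrite mxE sum_mxtens_index.
  under eq_bigr => k _.
    (* The identity factor keeps only the terms with equal second indices. *)
    rewrite (bigD1 j) //= big1 => [|l lj]; last first.
      by rewrite tensmxE !mxE (negPf lj) !mulr0.
    rewrite tensmxE !mxE eqxx mulr1 addr0; over.
  over.
rewrite exchange_big; apply: eq_bigr => k _.
by rewrite mxE mulr_suml.
Qed.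

Lemma trace_ptrace1_mul D1 D2 (A : 'M[R[i]]_(D1 * D2)) (X : 'M[R[i]]_D2) :
  \tr (ptrace1 A *m X) = \tr (A *m (1%:M *t X)).
Proof.
rewrite /mxtrace sum_mxtens_index exchange_big; apply: eq_bigr => j _.
rewrite mxE; under [RHS]eq_bigr => i _.
  rewrite mxE sum_mxtens_index exchange_big.
  under eq_bigr => l _.
    rewrite (bigD1 i) //= big1 => [|k ki]; last first.
      by rewrite tensmxE !mxE (negPf ki) mul0r mulr0.
    rewrite tensmxE !mxE eqxx mul1r addr0; over.
  over.
rewrite exchange_big; apply: eq_bigr => l _.
by rewrite mxE mulr_suml.
Qed.

(* The differences a - s, b - s and 1 - a - b + s are the expectations of
   f (x) (1 - f), (1 - f) (x) f and (1 - f) (x) (1 - f). *)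
Lemma grand_sum_marginal_bounds D1 D2 (rho : 'M[R[i]]_(D1 * D2)) :
  (0 < D1)%N -> (0 < D2)%N -> density rho ->
  exists s a b : R[i],
    [/\ grand_sum rho = (D1 * D2)%:R * s,
        grand_sum (ptrace2 rho) = D1%:R * a,
        grand_sum (ptrace1 rho) = D2%:R * b
      & [/\ 0 <= s, s <= a, s <= b & a + b <= 1 + s]].
Proof.
move=> d1 d2 /densityP[rpsd trr].
pose f1 := proj_f1 R D1; pose f2 := proj_f1 R D2.
exists (\tr (rho *m (f1 *t f2))), (\tr (rho *m (f1 *t 1%:M))),
  (\tr (rho *m (1%:M *t f2))).
split; rewrite ?grand_sum_trace ?proj_f1_tens ?trace_ptrace2_mul
  ?trace_ptrace1_mul //.
have tens_ge0 X Y : psd X -> psd Y -> 0 <= \tr (rho *m (X *t Y)).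
  by move=> hX hY; apply: mxtrace_psd_mul_ge0 => //; exact: psd_tens.
have trB X Y : \tr (rho *m (X - Y)) = \tr (rho *m X) - \tr (rho *m Y).
  by rewrite mulmxBr raddfB.
have [p1 p2] : psd f1 /\ psd f2 by split; exact: psd_proj_f1.
have [q1 q2] := (psd_compl_proj_f1 d1, psd_compl_proj_f1 d2).
split; first exact: tens_ge0.
- by have := tens_ge0 _ _ p1 q2; rewrite tensmxBr trB subr_ge0.
- by have := tens_ge0 _ _ q1 p2; rewrite tensmxBl trB subr_ge0.
- rewrite -subr_ge0; have := tens_ge0 _ _ q1 q2.
  (* The unit trace of [rho] turns the 1 (x) 1 term into 1, leaving (1 - a) - (b - s). *)
  rewrite tensmxBr !tensmxBl !trB tensmx11 mulmx1 trr.
  by rewrite opprB addrACA -opprD.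
Qed.

(** * Grand sums and partial traces of combinations and products *)

Lemma grand_sumD d (A B : 'M[R[i]]_d) :
  grand_sum (A + B) = grand_sum A + grand_sum B.
Proof. by rewrite !grand_sum_trace mulmxDl mxtraceD mulrDr. Qed.

Lemma grand_sumZ d (c : R[i]) (A : 'M[R[i]]_d) :
  grand_sum (c *: A) = c * grand_sum A.
Proof. by rewrite !grand_sum_trace -scalemxAl mxtraceZ mulrCA. Qed.

Lemma grand_sum_tens D1 D2 (A : 'M[R[i]]_D1) (B : 'M[R[i]]_D2) :
  grand_sum (A *t B) = grand_sum A * grand_sum B.
Proof.
by rewrite !grand_sum_trace proj_f1_tens tensmx_mul mxtrace_tens natrM mulrACA.
Qed.

Lemma grand_sum_proj_f1 d : (0 < d)%N -> grand_sum (proj_f1 R d) = d%:R.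
Proof. by move=> d0; rewrite grand_sum_trace proj_f1_idem ?trace_proj_f1 ?mulr1. Qed.

Lemma ptrace2D D1 D2 (A B : 'M[R[i]]_(D1 * D2)) :
  ptrace2 (A + B) = ptrace2 A + ptrace2 B.
Proof.
by apply/matrixP => i k; rewrite !mxE -big_split; apply: eq_bigr => j _; rewrite !mxE.
Qed.

Lemma ptrace1D D1 D2 (A B : 'M[R[i]]_(D1 * D2)) :
  ptrace1 (A + B) = ptrace1 A + ptrace1 B.
Proof.
by apply/matrixP => i k; rewrite !mxE -big_split; apply: eq_bigr => j _; rewrite !mxE.
Qed.

Lemma ptrace2Z D1 D2 c (A : 'M[R[i]]_(D1 * D2)) : ptrace2 (c *: A) = c *: ptrace2 A.
Proof.
by apply/matrixP => i k; rewrite !mxE mulr_sumr; apply: eq_bigr => j _; rewrite !mxE.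
Qed.

Lemma ptrace1Z D1 D2 c (A : 'M[R[i]]_(D1 * D2)) : ptrace1 (c *: A) = c *: ptrace1 A.
Proof.
by apply/matrixP => i k; rewrite !mxE mulr_sumr; apply: eq_bigr => j _; rewrite !mxE.
Qed.

Lemma ptrace2_tens D1 D2 (A : 'M[R[i]]_D1) (B : 'M[R[i]]_D2) :
  ptrace2 (A *t B) = \tr B *: A.
Proof.
apply/matrixP => i k; rewrite !mxE mulr_suml; apply: eq_bigr => j _.
by rewrite tensmxE mulrC.
Qed.

Lemma ptrace1_tens D1 D2 (A : 'M[R[i]]_D1) (B : 'M[R[i]]_D2) :
  ptrace1 (A *t B) = \tr A *: B.
Proof.
apply/matrixP => i k; rewrite !mxE mulr_suml; apply: eq_bigr => j _.
by rewrite tensmxE.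
Qed.

(** * Density operators under products and mixtures *)

Lemma density_proj_f1 d : (0 < d)%N -> density (proj_f1 R d).
Proof.
by move=> d0; apply/densityP; split; [exact: psd_proj_f1|exact: trace_proj_f1].
Qed.

Lemma density_tens D1 D2 (A : 'M[R[i]]_D1) (B : 'M[R[i]]_D2) :
  density A -> density B -> density (A *t B).
Proof.
move=> /densityP[pA tA] /densityP[pB tB]; apply/densityP; split.
  exact: psd_tens.
by rewrite mxtrace_tens tA tB mulr1.
Qed.

Lemma density_convex d (A B : 'M[R[i]]_d) (p q : R) :
  0 <= p -> 0 <= q -> p + q = 1 -> density A -> density B ->
  density (p%:C *: A + q%:C *: B).
Proof.
move=> p0 q0 pq /densityP[pA tA] /densityP[pB tB]; apply/densityP; split.
  by apply: psdD; apply: psdZ; rewrite // lecR.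
by rewrite mxtraceD !mxtraceZ tA tB !mulr1 -rmorphD pq.
Qed.

(** * The two extremal families *)

Section ExtremalFamilies.

Variables (D1 D2 : nat) (r1 : 'M[R[i]]_D1) (r2 : 'M[R[i]]_D2) (p : R).
Hypotheses (d1 : (0 < D1)%N) (d2 : (0 < D2)%N).
Hypotheses (dr1 : density r1) (dr2 : density r2) (p01 : 0 <= p <= 1).

Lemma density_rho_min : density (rho_min r1 r2 p).
Proof.
have /andP[p0 p1] := p01.
apply: density_convex => //; first by rewrite subr_ge0.
- by rewrite addrC subrK.
- by apply: density_tens; exact: density_proj_f1.
- exact: density_tens.
Qed.

Lemma density_rho_max : density (rho_max r1 r2 p).
Proof.
have /andP[p0 p1] := p01.
(* The last two terms regroup as [1 - p] times an even mixture, so binary convexity applies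
   twice. *)
pose w := 2^-1 : R.
have w0 : 0 <= w by rewrite invr_ge0 ler0n.
have ww : w + w = 1 by rewrite /w; field.
have -> : rho_max r1 r2 p = p%:C *: (proj_f1 R D1 *t proj_f1 R D2)
    + (1 - p)%:C *: (w%:C *: (proj_f1 R D1 *t r2) + w%:C *: (r1 *t proj_f1 R D2)).
  by rewrite /rho_max scalerDr !scalerA -!rmorphM addrA.
apply: density_convex => //; first by rewrite subr_ge0.
- by rewrite addrC subrK.
- by apply: density_tens; exact: density_proj_f1.
- by apply: density_convex => //; apply: density_tens => //; exact: density_proj_f1.
Qed.

Hypotheses (e1 : expect (ket_f1 R D1) r1 = 0) (e2 : expect (ket_f1 R D2) r2 = 0).

Let g1 : grand_sum r1 = 0. Proof. by rewrite grand_sum_expect e1 mulr0. Qed.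
Let g2 : grand_sum r2 = 0. Proof. by rewrite grand_sum_expect e2 mulr0. Qed.
Let t1 : \tr r1 = 1. Proof. by case: dr1. Qed.
Let t2 : \tr r2 = 1. Proof. by case: dr2. Qed.

Lemma grand_sum_rho_min : grand_sum (rho_min r1 r2 p) = p%:C * (D1 * D2)%:R.
Proof.
rewrite grand_sumD !grand_sumZ !grand_sum_tens g1 mul0r mulr0 addr0.
by rewrite !grand_sum_proj_f1 // natrM.
Qed.

Lemma grand_sum_rho_max : grand_sum (rho_max r1 r2 p) = p%:C * (D1 * D2)%:R.
Proof.
rewrite !grand_sumD !grand_sumZ !grand_sum_tens g1 g2 mul0r !mulr0 !addr0.
by rewrite !grand_sum_proj_f1 // natrM.
Qed.

(** Each marginal is a mixture of f with weight [p] and an orthogonal state, whose grand sum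
    vanishes. *)
Lemma grand_sum_marginals_rho_min :
  grand_sum (ptrace2 (rho_min r1 r2 p)) = p%:C * D1%:R /\
  grand_sum (ptrace1 (rho_min r1 r2 p)) = p%:C * D2%:R.
Proof.
rewrite ptrace2D ptrace1D !ptrace2Z !ptrace1Z !ptrace2_tens !ptrace1_tens.
rewrite !grand_sumD !grand_sumZ !grand_sum_proj_f1 // !trace_proj_f1 //.
by rewrite g1 g2 !mulr0 !addr0 !mul1r.
Qed.

(** In each marginal f also survives from one of the two mixed terms, so its weight is p + (1 - p) /
    2; the orthogonal state again contributes 0. *)
Lemma grand_sum_marginals_rho_max :
  grand_sum (ptrace2 (rho_max r1 r2 p)) = ((1 + p) / 2)%:C * D1%:R /\
  grand_sum (ptrace1 (rho_max r1 r2 p)) = ((1 + p) / 2)%:C * D2%:R.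
Proof.
have h : (1 + p) / 2 = p + (1 - p) / 2 by field.
rewrite !ptrace2D !ptrace1D !ptrace2Z !ptrace1Z !ptrace2_tens !ptrace1_tens.
rewrite !grand_sumD !grand_sumZ !grand_sum_proj_f1 // !trace_proj_f1 //.
rewrite g1 g2 t1 t2 !mulr0 !addr0 !mul1r -!mulrDl.
by rewrite -[X in (X + _%:C) * _]/(real_complex R p) -rmorphD -h.
Qed.

Let DC0 : (D1 * D2)%:R != 0 :> R[i].
Proof. by rewrite pnatr_eq0 -lt0n muln_gt0 d1. Qed.

Lemma marginal_product_rho_min :
  grand_sum (ptrace2 (rho_min r1 r2 p)) * grand_sum (ptrace1 (rho_min r1 r2 p))
  = grand_sum (rho_min r1 r2 p) ^+ 2 / (D1 * D2)%:R.
Proof.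
have [-> ->] := grand_sum_marginals_rho_min.
rewrite grand_sum_rho_min mulrACA -[D1%:R * D2%:R]natrM.
by move: DC0; move: (D1 * D2)%:R p%:C => x y x0; field.
Qed.

Lemma marginal_product_rho_max :
  grand_sum (ptrace2 (rho_max r1 r2 p)) * grand_sum (ptrace1 (rho_max r1 r2 p))
  = ((D1 * D2)%:R + grand_sum (rho_max r1 r2 p)) ^+ 2 / (4 * (D1 * D2)%:R).
Proof.
have [-> ->] := grand_sum_marginals_rho_max.
rewrite grand_sum_rho_max mulrACA -[D1%:R * D2%:R]natrM.
rewrite -[X in (X + _) ^+ 2]mul1r -mulrDl.
(* With q = (1 + p) / 2 the claim becomes the rational identity q^2 D = (2 q D)^2 / (4 D). *)
have -> : 1 + p%:C = 2 * ((1 + p) / 2)%:C :> R[i].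
  rewrite -(rmorph_nat (real_complex R)) -rmorphM mulrC divfK ?pnatr_eq0 //.
  by rewrite rmorphD rmorph1.
by move: DC0; move: (D1 * D2)%:R ((1 + p) / 2)%:C => x y x0; field.
Qed.

End ExtremalFamilies.

(** Supplies states for the families: 1 - f is positive, is annihilated by f, and has trace d - 1,
    which is nonzero for d > 1. *)
Lemma exists_density_perp d : (1 < d)%N ->
  exists r : 'M[R[i]]_d, density r /\ expect (ket_f1 R d) r = 0.
Proof.
move=> d1; have d0 := ltnW d1.
exists ((d.-1%:R)^-1 *: (1%:M - proj_f1 R d)); split.
  apply/densityP; split.
    by apply: psdZ; [rewrite invr_ge0 ler0n | exact: psd_compl_proj_f1].
  rewrite mxtraceZ linearB /= mxtrace1 trace_proj_f1 //.
  rewrite -{2}(prednK d0) -natr1 addrK mulVf // pnatr_eq0 -lt0n.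
  by rewrite -ltnS prednK.
rewrite expect_trace -scalemxAl mulmxBl mul1mx.
by rewrite -/(proj_f1 R d) proj_f1_idem // subrr scaler0 mxtrace0.
Qed.

End GrandSum.

(** * The families, the bounds and their attainment *)

Theorem mainTheorem7 (R : realType) (D1 D2 : nat)
    (hD1 : (2 <= D1)%N) (hD2 : (2 <= D2)%N) :
  [/\ (* the two families *)
      forall (r1 : 'M[R[i]]_D1) (r2 : 'M[R[i]]_D2),
        density r1 -> density r2 ->
        expect (ket_f1 R D1) r1 = 0 -> expect (ket_f1 R D2) r2 = 0 ->
        forall p : R, 0 <= p <= 1 ->
        [/\ density (rho_min r1 r2 p) /\ density (rho_max r1 r2 p),
            grand_sum (rho_min r1 r2 p) = p%:C * (D1 * D2)%:R,
            grand_sum (rho_max r1 r2 p) = p%:C * (D1 * D2)%:R,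
            grand_sum (ptrace2 (rho_min r1 r2 p))
              * grand_sum (ptrace1 (rho_min r1 r2 p))
              = grand_sum (rho_min r1 r2 p) ^+ 2 / (D1 * D2)%:R
          & grand_sum (ptrace2 (rho_max r1 r2 p))
              * grand_sum (ptrace1 (rho_max r1 r2 p))
              = ((D1 * D2)%:R + grand_sum (rho_max r1 r2 p)) ^+ 2
                / (4 * (D1 * D2)%:R)],
      (* the bounds, for every density operator *)
      forall rho : 'M[R[i]]_(D1 * D2), density rho ->
        [/\ 0 <= grand_sum rho <= (D1 * D2)%:R,
            grand_sum rho ^+ 2 / (D1 * D2)%:R
              <= grand_sum (ptrace2 rho) * grand_sum (ptrace1 rho)
          & grand_sum (ptrace2 rho) * grand_sum (ptrace1 rho)
              <= ((D1 * D2)%:R + grand_sum rho) ^+ 2 / (4 * (D1 * D2)%:R)]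
    & (* both bounds are attained at every value of the grand sum *)
      forall s : R, 0 <= s <= (D1 * D2)%:R ->
        (exists rho : 'M[R[i]]_(D1 * D2),
           [/\ density rho, grand_sum rho = s%:C
             & grand_sum (ptrace2 rho) * grand_sum (ptrace1 rho)
                 = grand_sum rho ^+ 2 / (D1 * D2)%:R]) /\
        (exists rho : 'M[R[i]]_(D1 * D2),
           [/\ density rho, grand_sum rho = s%:C
             & grand_sum (ptrace2 rho) * grand_sum (ptrace1 rho)
                 = ((D1 * D2)%:R + grand_sum rho) ^+ 2
                   / (4 * (D1 * D2)%:R)])].
Proof.
have [d1 d2] := (ltnW hD1, ltnW hD2).
have D0 : (0 < D1 * D2)%N by rewrite muln_gt0 d1.
have DC0 : (D1 * D2)%:R != 0 :> R[i] by rewrite pnatr_eq0 -lt0n.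
have DR0 : (D1 * D2)%:R != 0 :> R by rewrite pnatr_eq0 -lt0n.
split=> [r1 r2 dr1 dr2 e1 e2 p p01|rho drho|s /andP[s0 sD]].
- split; first by split; [exact: density_rho_min|exact: density_rho_max].
  + exact: grand_sum_rho_min.
  + exact: grand_sum_rho_max.
  + exact: marginal_product_rho_min.
  + exact: marginal_product_rho_max.
- have [s [a [b [-> -> -> [s0 sa sb abs]]]]] := grand_sum_marginal_bounds d1 d2 drho.
  have [a0 b0] := (le_trans s0 sa, le_trans s0 sb).
  have DR : 0 <= (D1 * D2)%:R :> R[i] by rewrite ler0n.
  (* The product of marginals is now D a b; factoring D out leaves inequalities among [s], [a] and
     [b]. *)
  rewrite mulrACA -[D1%:R * D2%:R]natrM.
  split.
  + rewrite mulr_ge0 //= -[leRHS]mulr1 ler_wpM2l //.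
    (* s <= 1 follows from s + s <= a + b <= 1 + s. *)
    by rewrite -(lerD2r s); apply: le_trans abs; exact: lerD.
  + have -> : ((D1 * D2)%:R * s) ^+ 2 / (D1 * D2)%:R = (D1 * D2)%:R * (s * s).
      by move: DC0; move: (D1 * D2)%:R => x x0; field.
    rewrite ler_wpM2l //.
    exact: ler_pM.
  + have -> : ((D1 * D2)%:R + (D1 * D2)%:R * s) ^+ 2 / (4 * (D1 * D2)%:R)
        = (D1 * D2)%:R * ((1 + s) ^+ 2 / 4).
      by move: DC0; move: (D1 * D2)%:R => x x0; field.
    rewrite ler_wpM2l // ler_pdivlMr ?ltr0n //.
    have h : (a + b) ^+ 2 <= (1 + s) ^+ 2.
      by rewrite ler_pXn2r // nnegrE ?addr_ge0.
    apply: le_trans h; rewrite -subr_ge0.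
    (* Arithmetic-geometric mean inequality. Over the complex numbers this square is nonnegative
       because [a] and [b], being nonnegative, are real. *)
    have -> : (a + b) ^+ 2 - a * b * 4 = (a - b) ^+ 2 by ring.
    by rewrite real_exprn_even_ge0 // rpredB ?ger0_real.
(* Both families have grand sum p D, so p = s / D realizes the prescribed value [s]. *)
- have p01 : 0 <= s / (D1 * D2)%:R <= 1.
    by rewrite divr_ge0 ?ler0n //= ler_pdivrMr ?ltr0n // mul1r.
  have [r1 [dr1 e1]] := exists_density_perp R hD1.
  have [r2 [dr2 e2]] := exists_density_perp R hD2.
  have sE : (s / (D1 * D2)%:R)%:C * (D1 * D2)%:R = s%:C :> R[i].
    by rewrite -(rmorph_nat (real_complex R)) -rmorphM divfK.
  split; [exists (rho_min r1 r2 (s / (D1 * D2)%:R))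
         |exists (rho_max r1 r2 (s / (D1 * D2)%:R))].
    split; first exact: density_rho_min.
      by rewrite grand_sum_rho_min.
    exact: marginal_product_rho_min.
  split; first exact: density_rho_max.
    by rewrite grand_sum_rho_max.
  exact: marginal_product_rho_max.
Qed.
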